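(* Let $\mathcal{APS}_4$ be the set of all nonnegative integers that occur as the number of points of $\mathbb{Z}^4$ in the relative interior of a lattice square $\mathrm{conv}\{0,u,v,u+v\}$, where $u,v\in\mathbb{Z}^4$ are nonzero with $u\cdot v=0$ and $u\cdot u=v\cdot v$. Then: (i) $\mathcal{APS}_4$ contains every odd positive integer; (ii) for every prime $p\ge 11$, the even number $p-1$ belongs to $\mathcal{APS}_4$.
   Context: This set is called the sequence of almost perfect squares in dimension 4. For such a square $\square$ with Ehrhart polynomial $E_\square$ (so $E_\square(t)=\#(t\square\cap\mathbb{Z}^4)$ for positive integers $t$), the number of lattice points in its relative interior equals $E_\square(-1)$. *)

(* Defs.v *)
From HB Require Import structures.
From mathcomp Require Import all_boot all_order all_algebra.
Set Implicit Arguments. Unset Strict Implicit. Unset Printing Implicit Defensive.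
Import Order.TTheory GRing.Theory Num.Theory.
Local Open Scope ring_scope.

Definition pt4 := 'rV[int]_4.

Definition dot4 (u v : pt4) : int := \sum_(i < 4) u 0 i * v 0 i.

(* x lies in the relative interior of the square conv{0,u,v,u+v}
   (u, v nonzero and orthogonal, so the square is the 2-dimensional
   parallelogram {s u + t v | 0 <= s,t <= 1} and its relative interior is
   {s u + t v | 0 < s,t < 1}).  Coefficients are taken rational: for a
   lattice point x and linearly independent integer u, v, real
   coefficients are automatically rational. *)
Definition in_relint_square (u v x : pt4) : Prop :=
  exists s t : rat, [/\ 0 < s < 1, 0 < t < 1 &
    forall i : 'I_4, (x 0 i)%:~R = s * (u 0 i)%:~R + t * (v 0 i)%:~R].

Definition relint_count_is (u v : pt4) (n : nat) : Prop :=
  exists s : seq pt4, [/\ uniq s, size s = n &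
    forall x : pt4, x \in s <-> in_relint_square u v x].

Definition APS4 (n : nat) : Prop :=
  exists u v : pt4, [/\ u != 0, v != 0, dot4 u v = 0, dot4 u u = dot4 v v
                      & relint_count_is u v n].

(* Main.v *)
Require Import Defs.
From mathcomp Require Import all_boot all_order all_algebra.
From mathcomp Require Import zify ring.
Import Order.TTheory GRing.Theory Num.Theory.
Local Open Scope ring_scope.

(** If [(e, f)] is a basis of the lattice points of its plane, [u = g e] and
    [v = m f - k e] with [gcd(m, k) = 1], then the open square spanned by [u] and
    [v] contains [g (m - 1)] lattice points.

    For an odd prime [p], take [g = 1], [m = p].  Write [p] as the norm of a
    quaternion [al = a + b i + c j + d k] with [a], [b] nonzero.  If [c = d = 0],
    the planar square [u = (a, b)], [v = (-b, a)] works.  Otherwise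
    [u = al^2 = 2 a al - p] and [v = al i al = - 2 b al + p i] are orthogonal of
    norm [p^2], proportional modulo [p], and the gcd of their 2x2 minors is
    exactly [p].

    For odd [n], take [g = n], [m = 2], [e = (1, 1, 0, 0)] and
    [v = (x, -x, y + z, y - z)], where [(x, y, z)] is a primitive solution of
    [x^2 + y^2 + z^2 = n^2] with [x] odd.  Such a solution is built one prime
    factor of [n] at a time, by conjugating with a quaternion of prime norm. *)

(** * Primes as sums of four squares *)

Lemma balanced_rem (x m : int) : 0 < m ->
  exists y k : int, [/\ x = y + m * k, - m <= 2 * y & 2 * y <= m].
Proof.
move=> m0; have := divz_eq x m; have := modz_ge0 x (lt0r_neq0 m0).
have := ltz_pmod x m0; set r := (x %% m)%Z; set q := (x %/ m)%Z => r1 r0 xE.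
have [h|h] := leP (2 * r) m; [exists r, q | exists (r - m), (q + 1)]; split; lia.
Qed.

(** Pigeonhole in ['F_p]: with [p = 2h + 1] and [i, j] running over [0..h], the residues [i^2] and
    [-1 - j^2] form two sets of size [h + 1], which must meet. *)
Lemma prime_neg1_sum2 (p : nat) : prime p -> odd p ->
  exists (m : nat) (a b : int), (0 < m < p)%N /\ a ^+ 2 + b ^+ 2 + 1 = m%:Z * p%:Z.
Proof.
move=> pp po; have [h pE] : exists h, p = h.*2.+1.
  by exists p./2; rewrite -[LHS]odd_double_half po.
have Fp0 (x : int) : (x%:~R == 0 :> 'F_p) -> (p%:Z %| x)%Z.
  have N (k : nat) : (k%:R == 0 :> 'F_p) = (p %| k)%N by rewrite -(dvdn_pcharf (pchar_Fp pp)).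
  case: x => k; rewrite ?NegzE ?rmorphN ?oppr_eq0 ?dvdzE ?abszN -?pmulrn N //.
pose f (i : 'I_h.+1) : 'F_p := (i%:Z ^+ 2)%:~R.
pose g (i : 'I_h.+1) : 'F_p := (- 1 - i%:Z ^+ 2)%:~R.
have finj : injective f.
  move=> i j /eqP; rewrite -subr_eq0 -rmorphB /= => /Fp0.
  rewrite (_ : _ - _ = (i%:Z - j%:Z) * (i%:Z + j%:Z)); last by ring.
  rewrite dvdzE abszM Euclid_dvdM //= => H; apply/val_inj => /=.
  have := ltn_ord i; have := ltn_ord j.
  by case/orP: H => /dvdnP [[|k] H]; nia.
have ginj : injective g.
  move=> i j /eqP; rewrite -subr_eq0 -rmorphB /= => H; apply: finj; apply/eqP.
  rewrite eq_sym -subr_eq0 -rmorphB /=; move: H; congr (_%:~R == 0); ring.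
have [[i j] H]: exists ij, f ij.1 = g ij.2.
  have [/set0Pn|] := boolP (f @: setT :&: g @: setT != set0).
    case=> x /setIP [/imsetP [i _ ->] /imsetP [j _ H]]; by exists (i, j).
  rewrite negbK => /eqP H; have := cardsUI (f @: setT) (g @: setT).
  rewrite H cards0 !card_imset // !cardsT card_ord => E.
  have := subset_leq_card (subsetT (f @: setT :|: g @: setT)).
  by rewrite cardsT card_Fp // -[X in (X <= _)%N]addn0 E; lia.
move/eqP: H; rewrite -subr_eq0 -rmorphB /= => /Fp0 /dvdzP [q].
have := ltn_ord i; have := ltn_ord j => lj li H.
have E : i%:Z ^+ 2 + j%:Z ^+ 2 + 1 = q * p%:Z by rewrite -H; ring.
have p0 : 0 < p%:Z by rewrite pE.
have q0 : 0 < q by rewrite -(pmulr_lgt0 _ p0) -E; nia.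
(* The bound comes from [i, j <= h], since [2 h^2 + 1 < (2h + 1)^2]. *)
have qp : q < p%:Z.
  rewrite -(ltr_pM2r p0) -E pE.
  have : i%:Z ^+ 2 <= h%:Z ^+ 2 by nia.
  have : j%:Z ^+ 2 <= h%:Z ^+ 2 by nia.
  have -> : h.*2.+1%:Z = 2 * h%:Z + 1 by lia.
  have := prime_gt1 pp; nia.
exists `|q|%N, i%:Z, j%:Z; split; first by lia.
by rewrite E gtz0_abs.
Qed.

Definition sumsq4 (a b c d : int) : int := a ^+ 2 + b ^+ 2 + c ^+ 2 + d ^+ 2.

(** Lagrange's descent: reduce the quaternion [(a, b, c, d)] modulo [m] to a [y] with small
    coordinates. Its norm is [m r] with [r <= m], and multiplying by [y] allows a division by
    [m]. *)
Lemma sum4_descent (p m : nat) (a b c d : int) : prime p -> (1 < m < p)%N ->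
  sumsq4 a b c d = m%:Z * p%:Z ->
  exists (r : nat) (a' b' c' d' : int),
    (0 < r < m)%N /\ sumsq4 a' b' c' d' = r%:Z * p%:Z.
Proof.
move=> pp /andP[m1 mp] S; have m0 : 0 < m%:Z by lia.
have [y1 [k1 [e1 l1 u1]]] := balanced_rem a _ m0.
have [y2 [k2 [e2 l2 u2]]] := balanced_rem b _ m0.
have [y3 [k3 [e3 l3 u3]]] := balanced_rem c _ m0.
have [y4 [k4 [e4 l4 u4]]] := balanced_rem d _ m0.
have ndvd q : p%:Z <> m%:Z * q.
  move=> E; have /prime_nt_dvdP : (m %| p)%N by have := dvdz_mulr q (dvdzz m%:Z); rewrite -E dvdzE.
  by move=> /(_ pp) ; lia.
have sq (y : int) : - m%:Z <= 2 * y -> 2 * y <= m%:Z -> 4 * y ^+ 2 <= m%:Z ^+ 2.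
  by move=> *; nia.
pose r := p%:Z - 2 * (y1 * k1 + y2 * k2 + y3 * k3 + y4 * k4)
  - m%:Z * sumsq4 k1 k2 k3 k4.
have Sy : sumsq4 y1 y2 y3 y4 = m%:Z * r.
  by rewrite /r !mulrBr -S e1 e2 e3 e4 /sumsq4; ring.
have Sk : p%:Z = r + 2 * (y1 * k1 + y2 * k2 + y3 * k3 + y4 * k4)
  + m%:Z * sumsq4 k1 k2 k3 k4 by rewrite /r; ring.
have r_le : r <= m%:Z.
  have : m%:Z * (4 * r) <= m%:Z * (4 * m%:Z).
    rewrite mulrCA -Sy /sumsq4 mulrCA.
    have := sq _ l1 u1; have := sq _ l2 u2; have := sq _ l3 u3; have := sq _ l4 u4.
    rewrite -[m%:Z * m%:Z]expr2; lia.
  rewrite ler_pM2l //; lia.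
have r_ge : 0 <= r.
  by rewrite -(pmulr_rge0 _ m0) -Sy /sumsq4 !addr_ge0 ?sqr_ge0.
have r_neq0 : r != 0.
  apply/eqP => r0; move: Sy; rewrite r0 mulr0 /sumsq4 => Sy.
  have [z1 z2 z3 z4] : [/\ y1 = 0, y2 = 0, y3 = 0 & y4 = 0] by split; nia.
  by apply: (ndvd (sumsq4 k1 k2 k3 k4)); rewrite Sk r0 z1 z2 z3 z4; ring.
(* Equality forces every [2 y_i] to be [m] or [-m]; then [m] divides [p], against [1 < m < p]. *)
have r_neqm : r != m%:Z.
  apply/eqP => rm.
  have E : 4 * y1 ^+ 2 = m%:Z ^+ 2 /\ 4 * y2 ^+ 2 = m%:Z ^+ 2 /\
           4 * y3 ^+ 2 = m%:Z ^+ 2 /\ 4 * y4 ^+ 2 = m%:Z ^+ 2.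
    move: Sy; rewrite rm /sumsq4 -[m%:Z * m%:Z]expr2.
    have := sq _ l1 u1; have := sq _ l2 u2; have := sq _ l3 u3; have := sq _ l4 u4.
    lia.
  have half y : 4 * y ^+ 2 = m%:Z ^+ 2 -> exists s : int, 2 * y = m%:Z * s.
    move=> Ey; have /eqP : (2 * y - m%:Z) * (2 * y + m%:Z) = 0 by rewrite -[RHS](subrr (m%:Z ^+ 2)) -{1}Ey; ring.
    by rewrite mulf_eq0 => /orP[] /eqP ?; [exists 1 | exists (-1)]; lia.
  case: E => /half [s1 h1] [/half [s2 h2] [/half [s3 h3] /half [s4 h4]]].
  apply: (ndvd (1 + (s1 * k1 + s2 * k2 + s3 * k3 + s4 * k4) + sumsq4 k1 k2 k3 k4)).
  rewrite Sk rm !mulrDr !mulrA -h1 -h2 -h3 -h4; ring.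
(* The witness is the quaternion product of [y] with the conjugate of [(a, b, c, d)], divided by
   [m]; its norm is [(m r)(m p) / m^2]. Substituting [y + m k] for [(a, b, c, d)] shows that it is
   integral. *)
exists `|r|%N,
  (r + (k1 * y1 + k2 * y2 + k3 * y3 + k4 * y4)),
  (k1 * y2 - k2 * y1 + k3 * y4 - k4 * y3),
  (k1 * y3 - k3 * y1 + k4 * y2 - k2 * y4),
  (k1 * y4 - k4 * y1 + k2 * y3 - k3 * y2).
split; first by lia.
rewrite (gez0_abs r_ge).
apply: (mulfI (_ : m%:Z ^+ 2 != 0)); first by rewrite expf_neq0 ?lt0r_neq0.
transitivity ((m%:Z * r) * (m%:Z * p%:Z)); last by ring.
rewrite -S -Sy.
transitivity (sumsq4 (m%:Z * r + m%:Z * (k1 * y1 + k2 * y2 + k3 * y3 + k4 * y4))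
  (m%:Z * (k1 * y2 - k2 * y1 + k3 * y4 - k4 * y3))
  (m%:Z * (k1 * y3 - k3 * y1 + k4 * y2 - k2 * y4))
  (m%:Z * (k1 * y4 - k4 * y1 + k2 * y3 - k3 * y2))).
  by rewrite /sumsq4; ring.
rewrite -Sy e1 e2 e3 e4 /sumsq4; ring.
Qed.

Lemma prime_sum4 (p : nat) : prime p -> odd p ->
  exists a b c d : int, sumsq4 a b c d = p%:Z.
Proof.
move=> pp po; have [m [a [b [mp H]]]] := prime_neg1_sum2 _ pp po.
have {H} : sumsq4 a b 1 0 = m%:Z * p%:Z by rewrite -H /sumsq4; ring.
elim/ltn_ind: m a b (1 : int) (0 : int) mp => m IH a b c d /andP[m0 mp] H.
have [m1|m1] := leqP m 1.
  by exists a, b, c, d; rewrite H (_ : m = 1%N) ?mul1r //; lia.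
have [|r [a' [b' [c' [d' [r1 H']]]]]] := sum4_descent _ _ _ _ _ _ pp _ H; first by rewrite m1.
by apply: (IH r) H'; lia.
Qed.

Lemma int_sqr_neq_prime (p : nat) (a : int) : prime p -> a ^+ 2 <> p%:Z.
Proof.
move=> pp H; have E : (`|a| * `|a|)%N = p by nia.
have : (`|a| %| p)%N by rewrite -E dvdn_mulr.
have := prime_gt1 pp => p1.
by case/primeP: pp => _ /[apply] /orP[] /eqP; nia.
Qed.

(** A prime is not a square, so at least two of the four terms are nonzero; a permutation brings
    them to the front. *)
Lemma prime_sum4_neq0 (p : nat) : prime p -> odd p ->
  exists a b c d : int, [/\ sumsq4 a b c d = p%:Z, a != 0 & b != 0].
Proof.
move=> pp po; have [a [b [c [d]]]] := prime_sum4 _ pp po.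
have N x : x ^+ 2 <> p%:Z by apply: int_sqr_neq_prime.
rewrite /sumsq4 => H.
have [a0|a0] := eqVneq a 0; have [b0|b0] := eqVneq b 0;
  have [c0|c0] := eqVneq c 0; have [d0|d0] := eqVneq d 0;
  first [ by exists a, b, c, d; split=> //; rewrite -H; ring
        | by exists a, c, b, d; split=> //; rewrite -H; ring
        | by exists a, d, b, c; split=> //; rewrite -H; ring
        | by exists b, c, a, d; split=> //; rewrite -H; ring
        | by exists b, d, a, c; split=> //; rewrite -H; ring
        | by exists c, d, a, b; split=> //; rewrite -H; ring
        | by case: (N (a + b + c + d)); rewrite -H ?a0 ?b0 ?c0 ?d0; ring ].
Qed.

(** * Counting lattice points *)

Lemma dot4_lin (w x y : pt4) (a b : int) :
  dot4 w (a *: x + b *: y) = a * dot4 w x + b * dot4 w y.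
Proof.
rewrite /dot4 !mulr_sumr -big_split; apply: eq_bigr => i _.
by rewrite !mxE /=; ring.
Qed.

Lemma dot4_rat (w x u v : pt4) (s t : rat) :
  (forall i, (x 0 i)%:~R = s * (u 0 i)%:~R + t * (v 0 i)%:~R) ->
  (dot4 w x)%:~R = s * (dot4 w u)%:~R + t * (dot4 w v)%:~R :> rat.
Proof.
move=> H; rewrite /dot4 !rmorph_sum !mulr_sumr -big_split; apply: eq_bigr => i _ /=.
by rewrite !rmorphM /= H; ring.
Qed.

(** The dual vectors [phi], [psi] read off the coordinates of [x = Y e + Z f]. Such an [x] is
    interior iff [0 < Z < m] and [0 < m Y + k Z < m g]. For each of the [m - 1] values of [Z],
    coprimality makes [k Z] nonzero modulo [m], which leaves exactly [g] values of [Y]. *)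
Lemma relint_count_basis (e f phi psi : pt4) (g m : nat) (k : int) :
  dot4 phi e = 1 -> dot4 phi f = 0 -> dot4 psi e = 0 -> dot4 psi f = 1 ->
  (0 < g)%N -> (0 < m)%N -> coprimez m k ->
  relint_count_is (g%:Z *: e) (m%:Z *: f - k *: e) (g * (m - 1)).
Proof.
move=> fe ff se sf g0 m0 cop.
have lphi a b : dot4 phi (a *: e + b *: f) = a by rewrite dot4_lin fe ff mulr1 mulr0 addr0.
have lpsi a b : dot4 psi (a *: e + b *: f) = b by rewrite dot4_lin se sf mulr1 mulr0 add0r.
have uE : g%:Z *: e = g%:Z *: e + 0 *: f by rewrite scale0r addr0.
have vE : m%:Z *: f - k *: e = - k *: e + m%:Z *: f by rewrite scaleNr addrC.
pose q (z : int) := (k * z %/ m)%Z; pose r (z : int) := (k * z %% m)%Z.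
have qr z : k * z = q z * m%:Z + r z := divz_eq _ _.
have r_ge z : 0 <= r z by apply: modz_ge0; lia.
have r_lt z : r z < m%:Z by apply: ltz_pmod; lia.
have r_gt z : 0 < z -> z < m%:Z -> 0 < r z.
  move=> z0 zm; rewrite lt0r r_ge andbT; apply/negP => /eqP rz.
  have : (m%:Z %| k * z)%Z by apply/dvdz_mod0P.
  by rewrite Gauss_dvdzr // => /dvdzP [c E]; have [c0|c0] := lerP c 0; nia.
(* The successor makes [Z] start at 1, and the shift by [q] turns the range of [Y] into
   [0 <= y < g]. *)
pose pt (z y : nat) : pt4 := (y%:Z - q z.+1%:Z) *: e + z.+1%:Z *: f.
exists [seq pt z y | z <- iota 0 (m - 1), y <- iota 0 g]; split.
- apply: allpairs_uniq; rewrite ?iota_uniq // => -[z y] [z' y'] _ _ /= E.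
  have := congr1 (dot4 psi) E; rewrite !lpsi => -[Ez]; move: E; rewrite Ez => E.
  by have := congr1 (dot4 phi) E; rewrite !lphi => /addIr [->].
- by rewrite size_allpairs !size_iota mulnC.
move=> x; split.
- case/allpairsP => -[z y] /= [+ + ->]; rewrite !mem_iota !add0n => hz hy.
  pose Z := z.+1%:Z; have Z0 : 0 < Z by []. have Zm : Z < m%:Z by lia.
  have rZ : 0 < r Z by apply: r_gt.
  have := r_lt Z => r1.
  have N0 : 0 < m%:Z * y%:Z + r Z by rewrite ltr_wpDl // mulr_ge0.
  have N1 : m%:Z * y%:Z + r Z < (m * g)%:Z.
    have : m%:Z * (y%:Z + 1) <= m%:Z * g%:Z by rewrite ler_pM2l //; lia.
    by rewrite PoszM; lia.
  (* These solve [Y = s g - t k] and [Z = t m] for [Y = y - q Z], because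
     [m Y + k Z = m y + r Z]. *)
  pose t : rat := Z%:~R / m%:R; pose s : rat := (m%:Z * y%:Z + r Z)%:~R / (m * g)%:R.
  have mR : 0 < m%:R :> rat by rewrite ltr0n.
  have gR : 0 < g%:R :> rat by rewrite ltr0n.
  exists s, t; split.
  + rewrite divr_gt0 ?ltr0n ?ltr0z ?muln_gt0 ?m0 //=.
    by rewrite ltr_pdivrMr ?ltr0n ?muln_gt0 ?m0 // mul1r pmulrn ltr_int.
  + by rewrite divr_gt0 ?ltr0z //= ltr_pdivrMr // mul1r pmulrn ltr_int.
  move=> i; rewrite !mxE.
  have -> : s = (y%:R - (q Z)%:~R + k%:~R * Z%:~R / m%:R) / g%:R.
    rewrite -rmorphM /= qr /s natrM !rmorphD !rmorphM /=.
    by field; rewrite !lt0r_neq0.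
  rewrite /t !rmorphD !rmorphM !rmorphN !rmorphM /=.
  by field; rewrite !lt0r_neq0.
case=> s [t [/andP[s0 s1] /andP[t0 t1] H]].
have := dot4_rat phi _ _ _ _ _ H; have := dot4_rat psi _ _ _ _ _ H.
rewrite vE uE !lphi !lpsi; set Z := dot4 psi x; set Y := dot4 phi x.
rewrite rmorph0 mulr0 add0r => EZ EY.
have mR : 0 < m%:R :> rat by rewrite ltr0n.
have gR : 0 < g%:R :> rat by rewrite ltr0n.
have xE : x = Y *: e + Z *: f.
  apply/rowP => i; rewrite !mxE; apply/eqP; rewrite -(eqr_int rat); apply/eqP.
  rewrite H rmorphD !rmorphM /= EY EZ !mxE !rmorphD !rmorphM !rmorphN !rmorphM /=; ring.
have Z0 : 0 < Z by rewrite -(ltr0z rat) EZ mulr_gt0.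
have Zm : Z < m%:Z by rewrite -(ltr_int rat) EZ gtr_pMl.
have W : (m%:Z * Y + k * Z)%:~R = s * (m%:Z * g%:Z)%:~R :> rat.
  by rewrite rmorphD !rmorphM /= EY EZ rmorphN /=; ring.
have W0 : 0 < m%:Z * Y + k * Z.
  by rewrite -(ltr0z rat) W mulr_gt0 // ltr0z; nia.
have W1 : m%:Z * Y + k * Z < m%:Z * g%:Z.
  by rewrite -(ltr_int rat) W gtr_pMl // ltr0z; nia.
have := r_gt _ Z0 Zm; have := r_lt Z; have := qr Z => Eq r1 r0.
have [z Ez] : exists z : nat, Z = z.+1%:Z by exists `|Z|.-1%N; lia.
have [y Ey] : exists y : nat, Y + q Z = y%:Z.
  exists (absz (Y + q Z)); rewrite gez0_abs //; nia.
apply/allpairsP; exists (z, y); split; rewrite /= ?mem_iota; [lia|nia|].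
by rewrite xE /pt -Ey -Ez addrK.
Qed.

(** * Squares described by a lattice basis *)

Definition vec4 (a b c d : int) : pt4 := \row_(i < 4) [:: a; b; c; d]`_i.

Lemma dot4_vec4 a b c d a' b' c' d' :
  dot4 (vec4 a b c d) (vec4 a' b' c' d') = a * a' + b * b' + c * c' + d * d'.
Proof. by rewrite /dot4 !big_ord_recl big_ord0 !mxE /= addr0 !addrA. Qed.

Lemma dot4C (u v : pt4) : dot4 u v = dot4 v u.
Proof. by apply: eq_bigr => i _; rewrite mulrC. Qed.

Lemma dot40 (u : pt4) : dot4 u 0 = 0.
Proof. by apply: big1 => i _; rewrite mxE mulr0. Qed.

(** The last two equations encode orthogonality and equal length of [u = g e] and [v = m f - k e],
    the second one simplified by means of the first. *)
Lemma APS4_basis (e f phi psi : pt4) (g m : nat) (k : int) :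
  dot4 phi e = 1 -> dot4 phi f = 0 -> dot4 psi e = 0 -> dot4 psi f = 1 ->
  (0 < g)%N -> (0 < m)%N -> coprimez m k ->
  m%:Z * dot4 e f = k * dot4 e e ->
  m%:Z ^+ 2 * dot4 f f = (g%:Z ^+ 2 + k ^+ 2) * dot4 e e ->
  APS4 (g * (m - 1)).
Proof.
move=> fe ff se sf g0 m0 cop Eef Eff.
have uE : g%:Z *: e = g%:Z *: e + 0 *: f by rewrite scale0r addr0.
have vE : m%:Z *: f - k *: e = - k *: e + m%:Z *: f by rewrite scaleNr addrC.
have dE a b a' b' : dot4 (a *: e + b *: f) (a' *: e + b' *: f) =
    a * a' * dot4 e e + (a * b' + b * a') * dot4 e f + b * b' * dot4 f f.
  rewrite dot4_lin !(dot4C (_ + _)) !dot4_lin (dot4C f e); ring.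
exists (g%:Z *: e), (m%:Z *: f - k *: e); split; last exact: relint_count_basis fe ff se sf _ _ _.
- apply/eqP => E; have := congr1 (dot4 phi) E.
  by rewrite uE dot4_lin dot40 fe ff; lia.
- apply/eqP => E; have := congr1 (dot4 psi) E.
  by rewrite vE dot4_lin dot40 se sf; lia.
- rewrite uE vE dE.
  transitivity (g%:Z * (m%:Z * dot4 e f - k * dot4 e e)); first by ring.
  by rewrite Eef subrr mulr0.
- rewrite uE vE !dE.
  transitivity (k ^+ 2 * dot4 e e - 2 * k * (m%:Z * dot4 e f) + m%:Z ^+ 2 * dot4 f f); last by ring.
  by rewrite Eef Eff; ring.
Qed.

(* The coefficients [cij] witness that the 2x2 minors of [(e, f)] are coprime,
   so that [(e, f)] is a basis of the lattice points in its plane. *)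
Lemma APS4_minors (e0 e1 e2 e3 f0 f1 f2 f3 c01 c02 c03 c12 c13 c23 : int)
    (g m : nat) (k : int) :
  c01 * (e0 * f1 - e1 * f0) + c02 * (e0 * f2 - e2 * f0) +
  c03 * (e0 * f3 - e3 * f0) + c12 * (e1 * f2 - e2 * f1) +
  c13 * (e1 * f3 - e3 * f1) + c23 * (e2 * f3 - e3 * f2) = 1 ->
  (0 < g)%N -> (0 < m)%N -> coprimez m k ->
  m%:Z * (e0 * f0 + e1 * f1 + e2 * f2 + e3 * f3) = k * sumsq4 e0 e1 e2 e3 ->
  m%:Z ^+ 2 * sumsq4 f0 f1 f2 f3 = (g%:Z ^+ 2 + k ^+ 2) * sumsq4 e0 e1 e2 e3 ->
  APS4 (g * (m - 1)).
Proof.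
move=> E g0 m0 cop Eef Eff.
(* With [w] the alternating form of coefficients [cij], the dual vectors are [w(_, f)] and
   [w(e, _)], and the Bezout relation says [w(e, f) = 1]. *)
apply: (@APS4_basis (vec4 e0 e1 e2 e3) (vec4 f0 f1 f2 f3)
  (vec4 (c01 * f1 + c02 * f2 + c03 * f3) (- c01 * f0 + c12 * f2 + c13 * f3)
        (- c02 * f0 - c12 * f1 + c23 * f3) (- c03 * f0 - c13 * f1 - c23 * f2))
  (vec4 (- c01 * e1 - c02 * e2 - c03 * e3) (c01 * e0 - c12 * e2 - c13 * e3)
        (c02 * e0 + c12 * e1 - c23 * e3) (c03 * e0 + c13 * e1 + c23 * e2)) g m k);
  rewrite ?dot4_vec4 -?expr2 //; by [ring | rewrite -E; ring].
Qed.

(** * The value [p - 1] for an odd prime [p] *)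

Lemma prime_coprimez (p : nat) (x : int) :
  prime p -> coprimez p x = ~~ (p%:Z %| x)%Z.
Proof. by move=> pp; rewrite coprimezE dvdzE prime_coprime. Qed.

Lemma prime_dvdzM (p : nat) (x y : int) :
  prime p -> (p%:Z %| x * y)%Z = (p%:Z %| x)%Z || (p%:Z %| y)%Z.
Proof. by move=> pp; rewrite !dvdzE abszM Euclid_dvdM. Qed.

Lemma small_ndvdz (p : nat) (x : int) : x != 0 -> `|x| < p%:Z -> ~~ (p%:Z %| x)%Z.
Proof.
move=> x0 xp; rewrite dvdzE gtnNdvd //; lia.
Qed.

Lemma sqr_lt_ndvdz (p : nat) (x : int) :
  x != 0 -> x ^+ 2 < p%:Z -> ~~ (p%:Z %| x)%Z.
Proof. by move=> x0 xp; apply: small_ndvdz => //; nia. Qed.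

Lemma sqr_int_gt0 (x : int) : x != 0 -> 0 < x ^+ 2.
Proof. by rewrite exprn_even_gt0. Qed.

Lemma prime_ndvdzB (p : nat) (s t : int) :
  prime p -> odd p -> 0 < s -> 0 < t -> s + t = p%:Z -> ~~ (p%:Z %| s - t)%Z.
Proof.
move=> pp po s0 t0 st; have -> : s - t = 2 * s - p%:Z by rewrite -st; ring.
have np2 : p != 2%N by apply: contraTneq po => ->.
have p1 := prime_gt1 pp.
by rewrite rpredBr ?dvdzz // prime_dvdzM // negb_or !small_ndvdz //; lia.
Qed.

Lemma APS4_sum2 (p : nat) (a b : int) :
  prime p -> a != 0 -> b != 0 -> a ^+ 2 + b ^+ 2 = p%:Z -> APS4 (p - 1).
Proof.
move=> pp a0 b0 E.
have a2 := sqr_int_gt0 _ a0; have b2 := sqr_int_gt0 _ b0.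
have na : coprimez a p by rewrite coprimez_sym prime_coprimez // sqr_lt_ndvdz //; lia.
have nb : ~~ (p%:Z %| b)%Z by rewrite sqr_lt_ndvdz //; lia.
have [A [B H]] := Bezoutz a p; rewrite (eqP na) in H.
have -> : (p - 1 = 1 * (p - 1))%N by rewrite mul1n.
have M : a * (A + a * B) + b * (b * B) = 1 by rewrite -H -E; ring.
(* Here [f] completes [e = (a, b)] to a basis of the plane lattice, and [p f - b A e = (-b, a)]
   because [A a + B p = 1]. *)
apply: (@APS4_minors a b 0 0 (- b * B) (A + a * B) 0 0 1 0 0 0 0 0 1 p (b * A)) => //.
- by rewrite -[RHS]M; ring.
- exact: prime_gt0.
- rewrite prime_coprimez // prime_dvdzM // negb_or nb /=.
  apply/negP => /dvdzP [c Ec].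
  have : (p%:Z %| 1%R)%Z by apply/dvdzP; exists (c * a + B); rewrite -[LHS]H Ec; ring.
  by rewrite dvdzE /= dvdn1 => /eqP p1; rewrite p1 in pp.
- by rewrite /sumsq4 -E; ring.
- have -> : sumsq4 a b 0 0 = p%:Z by rewrite -E /sumsq4; ring.
  have L : p%:Z * sumsq4 (- b * B) (A + a * B) 0 0 = 1 ^+ 2 + (b * A) ^+ 2.
    transitivity ((a * (A + a * B) + b * (b * B)) ^+ 2 + (b * A) ^+ 2); last by rewrite M.
    by rewrite -E /sumsq4; ring.
  by rewrite expr2 -mulrA L mulrC.
Qed.

Lemma APS4_sum4 (p : nat) (a b c d : int) :
  prime p -> odd p -> a != 0 -> b != 0 -> 0 < c ^+ 2 + d ^+ 2 ->
  sumsq4 a b c d = p%:Z -> APS4 (p - 1).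
Proof.
move=> pp po a0 b0 cd0 E; have E' := E; rewrite /sumsq4 in E'.
have a2 := sqr_int_gt0 _ a0; have b2 := sqr_int_gt0 _ b0.
have na : coprimez a p by rewrite coprimez_sym prime_coprimez // sqr_lt_ndvdz //; lia.
have nb : ~~ (p%:Z %| b)%Z by rewrite sqr_lt_ndvdz //; lia.
have nX : coprimez ((a ^+ 2 + b ^+ 2) - (c ^+ 2 + d ^+ 2)) p.
  rewrite coprimez_sym prime_coprimez //; apply: prime_ndvdzB => //; last by rewrite -E'; ring.
  by rewrite addr_gt0.
have [A' [B' H']] := Bezoutz a p; rewrite (eqP na) in H'.
have [A [B H]] := Bezoutz ((a ^+ 2 + b ^+ 2) - (c ^+ 2 + d ^+ 2)) p; rewrite (eqP nX) in H.
(* The residue [k] is [b / a] modulo [p], and [l] is the resulting quotient. They make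
   [f = 2 l al + i - k] satisfy [p f - k e = - 2 b al + p i] for [e = al^2]. *)
pose k := b * A'; pose l := - b * B'.
have kl : k * a - p%:Z * l = b by rewrite /k /l -[RHS]mulr1 -H'; ring.
set X := (a ^+ 2 + b ^+ 2) - (c ^+ 2 + d ^+ 2) in H.
have -> : (p - 1 = 1 * (p - 1))%N by rewrite mul1n.
have kn : coprimez p k.
  rewrite prime_coprimez //; apply: contra nb => /dvdzP [c' Ec].
  by apply/dvdzP; exists (c' * a - l); rewrite -kl Ec; ring.
clearbody k l.
apply: (@APS4_minors (2 * a * a - p%:Z) (2 * a * b) (2 * a * c) (2 * a * d)
  (2 * l * a - k) (2 * l * b + 1) (2 * l * c) (2 * l * d)
  (X * A ^+ 2 + 2 * A * p%:Z * B + B ^+ 2 * X) (B ^+ 2 * (2 * b * c)) (B ^+ 2 * (2 * b * d))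
  (- B ^+ 2 * (2 * a * c)) (- B ^+ 2 * (2 * a * d)) 0 1 p k) => //.
- have -> : (2 * a * a - p%:Z) * (2 * l * b + 1) - 2 * a * b * (2 * l * a - k) = X.
    transitivity (2 * a ^+ 2 + 2 * b * (k * a - p%:Z * l) - p%:Z); first by ring.
    by rewrite kl /X -E /sumsq4; ring.
  have -> : (2 * a * a - p%:Z) * (2 * l * c) - 2 * a * c * (2 * l * a - k) = 2 * b * c.
    by rewrite -kl; ring.
  have -> : (2 * a * a - p%:Z) * (2 * l * d) - 2 * a * d * (2 * l * a - k) = 2 * b * d.
    by rewrite -kl; ring.
  (* The squares of the minors of [(e, f)] sum to [p^2]. Squaring [A X + B p = 1] and replacing
     [p^2] by this sum yields the coefficients [cij] chosen above. *)
  have P2 : p%:Z ^+ 2 = X ^+ 2 + (2 * b * c) ^+ 2 + (2 * b * d) ^+ 2 + (2 * a * c) ^+ 2 + (2 * a * d) ^+ 2.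
    by rewrite /X -E /sumsq4; ring.
  apply: (@etrans _ _ ((A * X + B * p%:Z) ^+ 2)); last by rewrite H.
  transitivity ((X * A) ^+ 2 + 2 * (X * A * p%:Z * B) + p%:Z ^+ 2 * B ^+ 2); last by ring.
  by rewrite P2; ring.
- exact: prime_gt0.
- transitivity (p%:Z * (4 * a * l * sumsq4 a b c d + 2 * a * b - 2 * a * (k * a) - 2 * p%:Z * l * a + p%:Z * k)).
    by rewrite /sumsq4; ring.
  transitivity (k * (4 * a ^+ 2 * sumsq4 a b c d - 4 * p%:Z * a ^+ 2 + p%:Z ^+ 2)); last by rewrite /sumsq4; ring.
  by rewrite E -[X in 2 * a * X]kl; ring.
- have -> : sumsq4 (2 * a * a - p%:Z) (2 * a * b) (2 * a * c) (2 * a * d) = p%:Z ^+ 2.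
    transitivity (4 * a ^+ 2 * sumsq4 a b c d - 4 * p%:Z * a ^+ 2 + p%:Z ^+ 2); first by rewrite /sumsq4; ring.
    by rewrite E; ring.
  rewrite mulrC; congr (_ * _).
  transitivity (4 * l ^+ 2 * sumsq4 a b c d + 4 * l * (b - k * a) + 1 + k ^+ 2); first by rewrite /sumsq4; ring.
  by rewrite E -kl; ring.
Qed.

Lemma APS4_prime_pred (p : nat) : prime p -> odd p -> APS4 (p - 1).
Proof.
move=> pp po; have [a [b [c [d [E a0 b0]]]]] := prime_sum4_neq0 _ pp po.
have [cd|cd] := eqVneq (c ^+ 2 + d ^+ 2) 0.
  by apply: (APS4_sum2 _ _ _ pp a0 b0); rewrite -E /sumsq4 -(addrA _ (c ^+ 2)) cd addr0.
by apply: (APS4_sum4 _ _ _ _ _ pp po a0 b0 _ E); rewrite lt0r cd addr_ge0 ?sqr_ge0.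
Qed.

(** * Primitive triples of odd integral length *)

Definition primitive3 (x y z : int) : Prop :=
  forall q : nat, prime q -> ~ [/\ (q%:Z %| x)%Z, (q%:Z %| y)%Z & (q%:Z %| z)%Z].

Lemma primitive3_bezout (x y z : int) : primitive3 x y z ->
  exists A B C : int, A * x + B * y + C * z = 1.
Proof.
move=> pr; have [B [C H]] := Bezoutz y z; have [A [D H']] := Bezoutz x (gcdz y z).
exists A, (D * B), (D * C).
suff <- : gcdz x (gcdz y z) = 1 by rewrite -H' -H; ring.
set g := gcdz x (gcdz y z) in H' *; have g_ge0 : 0 <= g by [].
have [//|g1] := eqVneq g 1.
have [q qp qg] : exists2 q, prime q & (q%:Z %| g)%Z.
  have [->|g0] := eqVneq g 0; first by exists 2%N.
  exists (pdiv `|g|); first by apply: pdiv_prime; lia.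
  by rewrite dvdzE pdiv_dvd.
by case: (pr q qp); move: qg; rewrite !dvdz_gcd => /and3P[].
Qed.

(** The quantity not divisible by [p] is the top left entry of the conjugation matrix of
    [a + b i + c j + d k]. It is a difference of two positive integers with sum [p]. *)
Lemma prime_sum4_ndvd (p : nat) : prime p -> odd p ->
  exists a b c d : int,
    sumsq4 a b c d = p%:Z /\ ~~ (p%:Z %| a ^+ 2 + b ^+ 2 - c ^+ 2 - d ^+ 2)%Z.
Proof.
move=> pp po; have [a [b [c [d [E a0 b0]]]]] := prime_sum4_neq0 _ pp po.
have a2 := sqr_int_gt0 _ a0; have b2 := sqr_int_gt0 _ b0.
have [cd|cd] := eqVneq (c ^+ 2 + d ^+ 2) 0.
  have [c2 d2] : c ^+ 2 = 0 /\ d ^+ 2 = 0 by have := sqr_ge0 c; have := sqr_ge0 d; lia.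
  (* When [c = d = 0], the swap makes the two positive parts [a^2] and [b^2]. *)
  exists a, c, b, d; split; first by rewrite -E /sumsq4; ring.
  rewrite c2 d2 addr0 subr0; apply: prime_ndvdzB => //.
  by rewrite -E /sumsq4 c2 d2; ring.
exists a, b, c, d; split=> //; rewrite -addrA -opprD; apply: prime_ndvdzB => //.
- by lia.
- by rewrite lt0r cd addr_ge0 ?sqr_ge0.
- by rewrite -E /sumsq4; ring.
Qed.

Lemma primitive3_rot (x y z : int) : primitive3 x y z -> primitive3 y z x.
Proof. by move=> pr q qp [*]; apply: (pr q qp). Qed.

Lemma primitive3_ndvd_fst (p : nat) (N x y z : int) : prime p -> primitive3 x y z ->
  x ^+ 2 + y ^+ 2 + z ^+ 2 = N ->
  exists x' y' z' : int, [/\ primitive3 x' y' z', x' ^+ 2 + y' ^+ 2 + z' ^+ 2 = N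
    & ~~ (p%:Z %| x')%Z].
Proof.
move=> pp pr E; have pr' := primitive3_rot _ _ _ pr; have pr'' := primitive3_rot _ _ _ pr'.
have [hx|hx] := boolP (p%:Z %| x)%Z; last by exists x, y, z.
have [hy|hy] := boolP (p%:Z %| y)%Z; last by exists y, z, x; split=> //; rewrite -E; ring.
have [hz|hz] := boolP (p%:Z %| z)%Z; last by exists z, x, y; split=> //; rewrite -E; ring.
by case: (pr p pp).
Qed.

(* Conjugation by the quaternion [a + b i + c j + d k] of norm [p]: its matrix
   [R] satisfies [R^T R = p^2], so only [p] can divide the image of a primitive
   vector, and the sign change [(x, -y, -z)] avoids that. *)
Lemma primitive3_conj (p : nat) (N x y z : int) : prime p -> odd p ->
  primitive3 x y z -> x ^+ 2 + y ^+ 2 + z ^+ 2 = N ->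
  exists x' y' z' : int, primitive3 x' y' z' /\
    x' ^+ 2 + y' ^+ 2 + z' ^+ 2 = p%:Z ^+ 2 * N.
Proof.
move=> pp po pr0 /(primitive3_ndvd_fst _ _ _ _ _ pp pr0) {x y z pr0} [x [y [z [pr E nx]]]].
have [a [b [c [d [S nX]]]]] := prime_sum4_ndvd _ pp po.
pose P := 2 * (b * c - a * d); pose Q := 2 * (b * d + a * c).
set X := a ^+ 2 + b ^+ 2 - c ^+ 2 - d ^+ 2 in nX.
have n2 : ~~ (p%:Z %| 2%R)%Z by rewrite dvdzE /= dvdn_prime2 //; apply: contraTneq po => ->.
have [y1 [z1 [pr1 E1 n1]]] : exists y1 z1 : int, [/\ primitive3 x y1 z1,
    x ^+ 2 + y1 ^+ 2 + z1 ^+ 2 = N & ~~ (p%:Z %| X * x + P * y1 + Q * z1)%Z].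
  have [h|h] := boolP (p%:Z %| X * x + P * y + Q * z)%Z; last by exists y, z.
  exists (- y), (- z); split.
  - by move=> q qp [hx hy hz]; apply: (pr q qp); rewrite !dvdzE !abszN in hy hz *.
  - by rewrite !sqrrN.
  (* The first coordinates of the two images add up to [2 X x], which is prime to [p], so they are
     not both divisible by [p]. *)
  apply/negP => h'; have := rpredD h h'.
  have -> : X * x + P * y + Q * z + (X * x + P * - y + Q * - z) = 2 * (X * x) by ring.
  by rewrite (prime_dvdzM p 2) // (prime_dvdzM p X) // (negPf n2) (negPf nx) (negPf nX).
pose x' := X * x + P * y1 + Q * z1.
pose y' := 2 * (b * c + a * d) * x + (a ^+ 2 - b ^+ 2 + c ^+ 2 - d ^+ 2) * y1 + 2 * (c * d - a * b) * z1.
pose z' := 2 * (b * d - a * c) * x + 2 * (c * d + a * b) * y1 + (a ^+ 2 - b ^+ 2 - c ^+ 2 + d ^+ 2) * z1.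
exists x', y', z'; split; last first.
  by rewrite -S -E1 /x' /y' /z' /X /P /Q /sumsq4; ring.
move=> q qp [qx qy qz].
have [qp'|qp'] := eqVneq q p; first by move: n1; rewrite -qp' -/x' qx.
have red (w : int) : (q%:Z %| p%:Z ^+ 2 * w)%Z -> (q%:Z %| w)%Z.
  have npq : ~~ (q%:Z %| p%:Z)%Z by rewrite dvdzE dvdn_prime2.
  by rewrite !prime_dvdzM // (negPf npq).
(* Applying the transposed matrix to the image gives back [p^2] times the original vector. *)
apply: (pr1 q qp); split; apply: red; rewrite -S.
- have -> : sumsq4 a b c d ^+ 2 * x = X * x' + 2 * (b * c + a * d) * y' + 2 * (b * d - a * c) * z'.
    by rewrite /x' /y' /z' /X /P /Q /sumsq4; ring.
  by rewrite !rpredD // dvdz_mull.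
- have -> : sumsq4 a b c d ^+ 2 * y1 = P * x' + (a ^+ 2 - b ^+ 2 + c ^+ 2 - d ^+ 2) * y' + 2 * (c * d + a * b) * z'.
    by rewrite /x' /y' /z' /X /P /Q /sumsq4; ring.
  by rewrite !rpredD // dvdz_mull.
- have -> : sumsq4 a b c d ^+ 2 * z1 = Q * x' + 2 * (c * d - a * b) * y' + (a ^+ 2 - b ^+ 2 - c ^+ 2 + d ^+ 2) * z'.
    by rewrite /x' /y' /z' /X /P /Q /sumsq4; ring.
  by rewrite !rpredD // dvdz_mull.
Qed.

Lemma odd_sqr_primitive_sum3 (n : nat) : odd n ->
  exists x y z : int, primitive3 x y z /\ x ^+ 2 + y ^+ 2 + z ^+ 2 = n%:Z ^+ 2.
Proof.
elim/ltn_ind: n => n IH no.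
have [n1|n1] := leqP n 1.
  have -> : n = 1%N by case: n no n1 {IH} => [|[]].
  exists 1, 0, 0; split=> // q qp [+ _ _].
  by rewrite dvdzE /= dvdn1 => /eqP q1; rewrite q1 in qp.
have pp := pdiv_prime n1; set p := pdiv n in pp.
have [m nE] : exists m, n = (m * p)%N by apply/dvdnP/pdiv_dvd.
move: no; rewrite nE oddM => /andP[mo po].
have p1 := prime_gt1 pp.
have [|x [y [z [pr E]]]] := IH m _ mo; first by rewrite nE; nia.
have [x' [y' [z' [pr' E']]]] := primitive3_conj _ _ _ _ _ pp po pr E.
by exists x', y', z'; split=> //; rewrite E' PoszM; ring.
Qed.

(** * Odd values *)

Lemma int_parity (x : int) : exists r, x = 2 * r \/ x = 2 * r + 1.
Proof.
exists (x %/ 2)%Z; have := divz_eq x 2; have := modz_ge0 x (isT : (2 : int) != 0).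
have := ltz_pmod x (isT : (0 : int) < 2); lia.
Qed.

Lemma APS4_odd_triple (n : nat) (r S T : int) : odd n ->
  primitive3 (2 * r + 1) (2 * S) (2 * T) ->
  (2 * r + 1) ^+ 2 + (2 * S) ^+ 2 + (2 * T) ^+ 2 = n%:Z ^+ 2 -> APS4 n.
Proof.
move=> no /primitive3_bezout [A [B [C H]]] E.
have -> : n = (n * (2 - 1))%N by rewrite muln1.
(* Here [f = (v + e) / 2], integral since [x] is odd and [y], [z] are even. The minors are, up to
   sign, [x], [(y + z)/2], [(y - z)/2] and 0, so a Bezout relation for [(x, y, z)] supplies the
   [cij]. *)
apply: (@APS4_minors 1 1 0 0 (r + 1) (- r) (S + T) (S - T)
  (- A) (B + C) (B - C) 0 0 0 n 2 1) => //.
- by rewrite -[RHS]H; ring.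
- by case: n no {E}.
- by rewrite /sumsq4; ring.
- by rewrite -E /sumsq4; ring.
Qed.

Lemma APS4_odd (n : nat) : odd n -> APS4 n.
Proof.
move=> no; have [x [y [z [pr E]]]] := odd_sqr_primitive_sum3 _ no.
have pr' := primitive3_rot _ _ _ pr; have pr'' := primitive3_rot _ _ _ pr'.
have [h hE] : exists h : int, n%:Z = 2 * h + 1.
  by exists n./2%:Z; have := odd_double_half n; rewrite no; lia.
have [r rE] := int_parity x; have [s sE] := int_parity y; have [t tE] := int_parity z.
(* Since [n^2] is 1 modulo 4, exactly one coordinate is odd; a rotation moves it to the front. *)
case: rE sE tE => xE [] yE [] zE; rewrite xE yE zE in pr pr' pr'' E.
- by exfalso; rewrite hE in E; lia.
- by apply: (APS4_odd_triple _ _ _ _ no pr''); rewrite -E; ring.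
- by apply: (APS4_odd_triple _ _ _ _ no pr'); rewrite -E; ring.
- by exfalso; rewrite hE in E; lia.
- by apply: (APS4_odd_triple _ _ _ _ no pr).
- by exfalso; rewrite hE in E; lia.
- by exfalso; rewrite hE in E; lia.
- by exfalso; rewrite hE in E; lia.
Qed.

Local Close Scope ring_scope.

Theorem theorem2p13 :
  (forall n : nat, odd n -> APS4 n) /\
  (forall p : nat, prime p -> 11 <= p -> APS4 (p - 1)).
Proof.
split=> [|p pp p11]; first exact: APS4_odd.
by apply: APS4_prime_pred => //; case: (even_prime pp) p11 => [->|].
Qed.
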